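(* Let $G$ be a finite group, let $I$ and $\Lambda$ be finite (non-empty) index sets, and let $P=(p_{\lambda i})$ be a regular $\Lambda\times I$ matrix with entries in $G^0$ that contains at least one zero entry. Let $Q=P[\Lambda_Q|I_Q]$ be a $0$-closure submatrix of $P$ and let $\mathcal{C}$ be the connected component of $\mathcal{G}(\mathcal{M}_0[G;I,\Lambda;P])$ determined by $Q$. Then (1) $\mathrm{diam}(\mathcal{C})=0$ if and only if $|I_Q|=|\Lambda_Q|=1$ and $G$ is trivial. (2) $\mathrm{diam}(\mathcal{C})=1$ if and only if both of the following hold: (a) $|I_Q|>1$ or $|\Lambda_Q|>1$ or $G$ is not trivial; (b) all entries of $Q$ are $0$. (3) $\mathrm{diam}(\mathcal{C})=2$ if and only if all of the following hold: (a) $Q$ contains a non-zero entry; (b) for all distinct $\lambda,\mu\in\Lambda_Q$ there exists $i\in I_Q$ such that $p_{\lambda i}=p_{\mu i}=0$; (c) for all distinct $i,j\in I_Q$ there exists $\lambda\in\Lambda_Q$ such that $p_{\lambda i}=p_{\lambda j}=0$.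
   Context: $G^0=G\cup\{0\}$ is $G$ with a zero adjoined. A matrix over $G^0$ is regular if every row and every column contains a non-zero entry. The $0$-Rees matrix semigroup $\mathcal{M}_0[G;I,\Lambda;P]$ is the set $(I\times G\times\Lambda)\cup\{0\}$ with $(i,x,\lambda)(j,y,\mu)=(i,xp_{\lambda j}y,\mu)$ if $p_{\lambda j}\neq 0$, $(i,x,\lambda)(j,y,\mu)=0$ if $p_{\lambda j}=0$, and all products involving $0$ equal to $0$. The commuting graph $\mathcal{G}(S)$ of a finite non-commutative semigroup $S$ is the simple graph with vertex set $S\setminus Z(S)$ ($Z(S)$ the center), where distinct $x,y$ are adjacent iff $xy=yx$. (When $P$ is regular and has a zero entry, $\mathcal{M}_0[G;I,\Lambda;P]$ is non-commutative with center $\{0\}$.) $\mathrm{diam}$ is the maximum distance between two vertices. For $I'\subseteq I$, $\Lambda'\subseteq\Lambda$, $P[\Lambda'|I']$ is the submatrix of $P$ with rows indexed by $\Lambda'$ and columns by $I'$. $0$-closure method: let $p_{\lambda i}=0$. Put $I_0=\{i\}$, $\Lambda_0=\{\lambda\}$ and, for $k\ge 0$, $I_{k+1}=I_k\cup\{j\in I: p_{\mu j}=0\text{ for some }\mu\in\Lambda_k\}$ and $\Lambda_{k+1}=\Lambda_k\cup\{\mu\in\Lambda: p_{\mu j}=0\text{ for some }j\in I_k\}$. Let $\zeta(\lambda,i)$ be the least $k$ with $I_{k+1}=I_k$ and $\Lambda_{k+1}=\Lambda_k$. The $0$-closure $(\lambda,i)$-submatrix of $P$ is $P[\Lambda_k|I_k]$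 with $k=\zeta(\lambda,i)$. A $0$-closure submatrix of $P$ is a $0$-closure $(\lambda,i)$-submatrix for some $(\lambda,i)$ with $p_{\lambda i}=0$. If $Q=P[\Lambda_Q|I_Q]$ is a $0$-closure submatrix of $P$, the subgraph of $\mathcal{G}(\mathcal{M}_0[G;I,\Lambda;P])$ induced by $I_Q\times G\times\Lambda_Q$ is a connected component, called the connected component determined by $Q$ (this includes the case where the whole graph is connected and $Q=P$). *)

(* Defs.v *)
From HB Require Import structures.
From mathcomp Require Import all_boot all_fingroup.

Set Implicit Arguments.
Unset Strict Implicit.
Unset Printing Implicit Defensive.

Local Open Scope group_scope.

Record sgraph := SGraph {
  svertex :> finType;
  sedge : rel svertex;
  sedge_sym : symmetric sedge;
  sedge_irr : irreflexive sedge
}.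

Section Induced.
Variables (Gr : sgraph) (A : {set Gr}).

Definition induced_edge : rel {v : Gr | v \in A} :=
  fun u v => sedge (val u) (val v).

Lemma induced_edge_sym : symmetric induced_edge.
Proof. by move=> u v; apply: sedge_sym. Qed.

Lemma induced_edge_irr : irreflexive induced_edge.
Proof. by move=> u; apply: sedge_irr. Qed.

Definition induced : sgraph := SGraph induced_edge_sym induced_edge_irr.

End Induced.

Section Distance.
Variable Gr : sgraph.
Implicit Types x y : Gr.

Definition walk x y (n : nat) : bool :=
  [exists p : n.-tuple Gr, path (@sedge Gr) x p && (last x p == y)].

Lemma connect_walk x y : connect (@sedge Gr) x y -> exists n, walk x y n.
Proof.
case/connectP=> p xp ->; exists (size p).
by apply/existsP; exists (in_tuple p); rewrite /= xp eqxx.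
Qed.

(* [None] stands for an infinite distance. *)
Definition dist x y : option nat :=
  if @idP (connect (@sedge Gr) x y) is ReflectT xy
  then Some (ex_minn (connect_walk xy)) else None.

(* [None] stands for an infinite diameter; the [odflt] is never triggered. *)
Definition diam : option nat :=
  if [forall x, forall y, dist x y != None]
  then Some (\max_(x : Gr) \max_(y : Gr) odflt 0 (dist x y)) else None.

End Distance.

Section CommutingGraph.
(* A finite semigroup is a finite type with an associative operation. *)
Variables (S : finType) (op : SemiGroup.law S).

Definition semigroup_center : {set S} :=
  [set x : S | [forall y : S, op x y == op y x]].

Definition noncentral : finType := {x : S | x \notin semigroup_center}.

Definition commuting_edge : rel noncentral :=
  fun u v => (u != v) && (op (val u) (val v) == op (val v) (val u)).

Lemma commuting_edge_sym : symmetric commuting_edge.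
Proof. by move=> u v; rewrite /commuting_edge eq_sym [X in _ && X]eq_sym. Qed.

Lemma commuting_edge_irr : irreflexive commuting_edge.
Proof. by move=> u; rewrite /commuting_edge eqxx. Qed.

Definition commuting_graph : sgraph :=
  SGraph commuting_edge_sym commuting_edge_irr.

End CommutingGraph.

Section Rees.
(* [option gT] is the group with a zero adjoined, [None] being the zero. *)
Variables (gT : finGroupType) (I L : finType) (P : L -> I -> option gT).

Definition regular_matrix : Prop :=
  (forall l, exists i, P l i <> None) /\ (forall i, exists l, P l i <> None).

Definition rees0 : finType := option (I * gT * L).

Definition rees0_mul (a b : rees0) : rees0 :=
  if (a, b) is (Some (i, x, l), Some (j, y, m))
  then if P l j is Some p then Some (i, x * p * y, m) else None
  else None.

Lemma rees0_mulA : associative rees0_mul.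
Proof.
case=> [[[i x] l]|] [[[j y] m]|] [[[k z] n]|] //=; rewrite /rees0_mul.
- by case pmk: (P m k) => [q|]; case: (P l j) => [p|] //; rewrite pmk ?mulgA.
- by case: (P l j) => [p|].
Qed.

HB.instance Definition _ := SemiGroup.isLaw.Build rees0 rees0_mul rees0_mulA.

Fixpoint zclosure_step (l : L) (i : I) (k : nat) : {set I} * {set L} :=
  if k is k'.+1 then
    let: (A, B) := zclosure_step l i k' in
    (A :|: [set j | [exists m in B, P m j == None]],
     B :|: [set m | [exists j in A, P m j == None]])
  else ([set i], [set l]).

Definition zclosure_stable l i k : bool :=
  zclosure_step l i k.+1 == zclosure_step l i k.

Lemma zclosure_stabilises l i : exists k, zclosure_stable l i k.
Proof.
pose card k := (#|(zclosure_step l i k).1| + #|(zclosure_step l i k).2|)%N.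
case: (boolP [exists k : 'I_(#|I| + #|L|).+1, zclosure_stable l i k]).
  by case/existsP=> k kP; exists k.
rewrite negb_exists => /forallP unstable.
suff grow k : k <= (#|I| + #|L|).+1 -> k <= card k.
  have := leq_trans (grow _ (leqnn _)) (leq_add (max_card _) (max_card _)).
  by rewrite ltnn.
elim: k => // k IHk ltk; apply: leq_ltn_trans (IHk (ltnW ltk)) _.
have := unstable (Ordinal ltk); rewrite /zclosure_stable /card /=.
case: (zclosure_step l i k) => A B /=; rewrite xpair_eqE negb_and.
set A' := A :|: _; set B' := B :|: _.
have sA : A \subset A' by apply: subsetUl.
have sB : B \subset B' by apply: subsetUl.
case/orP=> neq.
- rewrite -addSn leq_add ?subset_leq_card // proper_card //.
  by rewrite properEneq eq_sym neq.
- rewrite -addnS leq_add ?subset_leq_card // proper_card //.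
  by rewrite properEneq eq_sym neq.
Qed.

Definition zeta l i : nat := ex_minn (zclosure_stabilises l i).

(* A submatrix P[LQ|IQ] is represented by its sets of row and column indices. *)
Definition zclosure_submatrix (LQ : {set L}) (IQ : {set I}) : Prop :=
  exists l i, P l i = None /\ zclosure_step l i (zeta l i) = (IQ, LQ).

Definition block (LQ : {set L}) (IQ : {set I}) : {set rees0} :=
  [set a : rees0 | if a is Some (i, _, l) then (i \in IQ) && (l \in LQ)
                   else false].

(* When P[LQ|IQ] is a 0-closure submatrix of P, this is the connected component
   of the commuting graph determined by it. *)
Definition component (LQ : {set L}) (IQ : {set I}) : sgraph :=
  @induced (commuting_graph rees0_mul)
    [set v : noncentral rees0_mul | val v \in block LQ IQ].

End Rees.

(* Main.v *)
Require Import Defs.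
From mathcomp Require Import all_boot all_fingroup.

(* Distinct non-zero elements [(i, x, l)] and [(j, y, m)] with [i <> j] or
   [l <> m] commute iff [P l j] and [P m i] both vanish.  In a 0-closure
   submatrix every row and every column has a zero, so two vertices are at
   distance at most 2 as soon as their rows share a zero column [k] and their
   columns share a zero row [n]: then [(k, 1, n)] commutes with both. *)

Set Implicit Arguments.
Unset Strict Implicit.
Unset Printing Implicit Defensive.

(** * Walks of bounded length and the diameter *)

Section DistanceTheory.
Variable Gr : sgraph.
Implicit Types x y z : Gr.

(** The reflexive closure lets a walk pause at a vertex; in a commuting graph it is exactly
    commutation. *)
Definition adj_or_eq x y := (x == y) || sedge x y.

Lemma walk0 x y : walk x y 0 = (x == y).
Proof.
apply/existsP/eqP => [[p]|->]; first by rewrite tuple0 /= => /eqP.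
by exists [tuple]; rewrite /= eqxx.
Qed.

Lemma walkS x y n : walk x y n.+1 = [exists z, sedge x z && walk z y n].
Proof.
apply/existsP/existsP => [[p]|[z /andP[xz /existsP[p zy]]]].
  case/tupleP: p => z p /=; rewrite -andbA => /andP[xz zy].
  by exists z; rewrite xz; apply/existsP; exists p.
by exists [tuple of z :: p]; rewrite /= xz.
Qed.

(** Distance at most [d], phrased by walks so as to avoid the option-valued [dist] and its
    minimum. *)
Definition within d x y := exists2 n, n <= d & walk x y n.

Lemma within0 x y : within 0 x y <-> x = y.
Proof.
split=> [[n]|->]; last by exists 0; rewrite ?walk0.
by rewrite leqn0 => /eqP->; rewrite walk0 => /eqP.
Qed.

(** An empty walk spends its first step staying in place; conversely, a first step that stays only
    wastes one unit of the bound. *)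
Lemma withinS d x y :
  within d.+1 x y <-> exists2 z, adj_or_eq x z & within d z y.
Proof.
split=> [[[_|n led]]|[z /predU1P[<-|xz] [n led zy]]].
- by rewrite walk0 => /eqP->; exists y; rewrite /adj_or_eq ?eqxx //;
    exists 0; rewrite ?walk0.
- rewrite walkS => /existsP[z /andP[xz zy]].
  by exists z; [rewrite /adj_or_eq xz orbT | exists n].
- by exists n; first exact: leqW.
- by exists n.+1; rewrite ?walkS //; apply/existsP; exists z; rewrite xz.
Qed.

Lemma within1 x y : within 1 x y <-> adj_or_eq x y.
Proof.
split=> [/withinS[z xz /within0 <-] //|xy].
by apply/withinS; exists y => //; apply/within0.
Qed.

Lemma within2 x y :
  within 2 x y <-> exists2 z, adj_or_eq x z & adj_or_eq z y.
Proof.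
by split=> [/withinS[z xz /within1]|[z xz /within1 zy]];
  [exists z | apply/withinS; exists z].
Qed.

Lemma walk_connect x y n : walk x y n -> connect (@sedge Gr) x y.
Proof. by case/existsP=> p /andP[xp /eqP<-]; apply/connectP; exists p. Qed.

Lemma dist_leP d x y :
  (exists2 n, n <= d & dist x y = Some n) <-> within d x y.
Proof.
rewrite /dist; split=> [[n led]|[n led xyn]].
  case: {-}_ / idP => // xy [def_n]; exists n => //.
  by rewrite -def_n; case: ex_minnP.
case: {-}_ / idP => [xy|[]]; last exact: walk_connect xyn.
case: ex_minnP => m _ min_m; exists m => //.
exact: leq_trans (min_m _ xyn) led.
Qed.

(** A uniform bound rules out [None]; once all distances are finite, the double maximum is at most
    [d] exactly when each of them is. *)
Lemma diam_leP d :
  (exists2 n, n <= d & diam Gr = Some n) <-> forall x y, within d x y.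
Proof.
rewrite /diam; split=> [[n led]|bound].
  case: ifP => // /forallP conn [def_n] x y.
  move: (conn x) => /forallP/(_ y); case xy: (dist x y) => [m|] // _.
  apply/dist_leP; exists m => //; apply: leq_trans led; rewrite -def_n.
  apply: leq_trans (leq_bigmax x); apply: leq_trans (leq_bigmax y).
  by rewrite xy.
have -> : [forall x : Gr, forall y, dist x y != None].
  apply/forallP=> x; apply/forallP=> y.
  by have /dist_leP[n _ ->] := bound x y.
eexists; last by [].
apply/bigmax_leqP=> x _; apply/bigmax_leqP=> y _.
by have /dist_leP[n led ->] := bound x y.
Qed.

Lemma diam_eq0 : diam Gr = Some 0 <-> forall x y, within 0 x y.
Proof.
split=> [d0|/diam_leP[n]]; first by apply/diam_leP; exists 0.
by rewrite leqn0 => /eqP->.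
Qed.

(** Reduces an exact diameter to two consecutive uniform bounds, so it remains to characterise
    [within] for 0, 1 and 2. *)
Lemma diam_eqS d :
  diam Gr = Some d.+1 <->
  (forall x y, within d.+1 x y) /\ ~ (forall x y, within d x y).
Proof.
split=> [dS|[/diam_leP[n]]].
  split; first by apply/diam_leP; exists d.+1.
  move/diam_leP=> [n led]; rewrite dS => -[def_n].
  by rewrite -def_n ltnn in led.
rewrite leq_eqVlt => /predU1P[-> //|led dn] [].
by apply/diam_leP; exists n.
Qed.

End DistanceTheory.

(** * Commutation and short distances in a block of the 0-Rees semigroup *)

Section ReesCommutation.
Variables (gT : finGroupType) (I L : finType) (P : L -> I -> option gT).

Definition commutes (a b : rees0 gT I L) := rees0_mul P a b == rees0_mul P b a.

Lemma commutes_zero i x l j y m :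
  P l j = None -> P m i = None -> commutes (Some (i, x, l)) (Some (j, y, m)).
Proof. by move=> lj mi; rewrite /commutes /rees0_mul lj mi. Qed.

(** Two equal products vanish together; if they are non-zero, comparing their outer coordinates
    identifies the indices. The equation in the group coordinate is dropped, so only one implication
    is claimed. *)
Lemma commutes_Some i x l j y m :
    commutes (Some (i, x, l)) (Some (j, y, m)) ->
  (P l j = None /\ P m i = None) \/ [/\ i = j, l = m & P l i <> None].
Proof.
rewrite /commutes /rees0_mul.
case lj: (P l j) => [p|]; case mi: (P m i) => [q|] // /eqP; last by left.
by case=> eq_ij _ eq_ml; right; split; rewrite ?eq_ij ?lj.
Qed.

Hypothesis P_regular : regular_matrix P.
Hypothesis P_zero : exists l i, P l i = None.

(** Suppose [(i, x, l)] is central. Regularity gives a non-zero entry in row [l], say in column [j];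
    commuting with each [(j, 1, m)] then forces [m = l], so [l] is the only row. The column of a
    zero of [P] then has no non-zero entry, against regularity. *)
Lemma Some_noncentral t : Some t \notin semigroup_center (rees0_mul P).
Proof.
case: t => [[i x] l]; apply/negP; rewrite inE => /forallP central.
have{central} comm j m : (P l j = None /\ P m i = None) \/ i = j /\ l = m.
  have := central (Some (j, 1%g, m)).
  by move/commutes_Some => [|[]]; [left | right].
have [reg_row reg_col] := P_regular.
have [[j lj] [l0 [i0 l0i0]]] := (reg_row l, P_zero).
have rows m : l = m by case: (comm j m) => [[/lj]|[]].
by have [m []] := reg_col i0; rewrite -(rows m) (rows l0).
Qed.

Variables (LQ : {set L}) (IQ : {set I}).
Let C := component P LQ IQ.

Definition entry (u : C) : rees0 gT I L := val (val u).

Lemma entry_inj : injective entry.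
Proof. by move=> u v /val_inj/val_inj. Qed.

Lemma entryP (u : C) :
  exists i x l, [/\ entry u = Some (i, x, l), i \in IQ & l \in LQ].
Proof.
case: u => -[a nca] a_in; rewrite /entry /=; move: a_in; rewrite !inE /=.
by case: a nca => [[[i x] l]|] // _ /andP[]; exists i, x, l.
Qed.

Lemma entry_surj i x l :
  i \in IQ -> l \in LQ -> exists u : C, entry u = Some (i, x, l).
Proof.
move=> iIQ lLQ.
pose v : noncentral (rees0_mul P) :=
  Sub (Some (i, x, l)) (Some_noncentral _).
have v_in : v \in [set v : noncentral (rees0_mul P) | val v \in block gT LQ IQ].
  by rewrite !inE /= iIQ.
by exists (exist _ v v_in).
Qed.

(** Every element commutes with itself, so the reflexive closure absorbs the condition [u != v] on
    edges. *)
Lemma component_adj_or_eq (u v : C) :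
  adj_or_eq u v = commutes (entry u) (entry v).
Proof.
rewrite /adj_or_eq /commutes /= /induced_edge /= /commuting_edge.
rewrite (inj_eq val_inj) /entry; case: eqVneq => [->|_] //=.
by rewrite eqxx.
Qed.

Hypothesis row_zero : forall l, l \in LQ -> exists2 i, i \in IQ & P l i = None.
Hypothesis col_zero : forall i, i \in IQ -> exists2 l, l \in LQ & P l i = None.

Lemma component_within0 :
    0 < #|IQ| -> 0 < #|LQ| ->
  (forall u v : C, within 0 u v) <->
  [/\ #|IQ| = 1, #|LQ| = 1 & [set: gT] = 1%g].
Proof.
move=> /card_gt0P[i0 i0IQ] /card_gt0P[l0 l0LQ]; split=> [eqC|[IQ1 LQ1 G1] u v].
  (* All triples over the block are vertices, hence equal; each coordinate is then varied alone
     around [(i0, 1, l0)]. *)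
  have uniq_entry i (x : gT) l j (y : gT) m :
      i \in IQ -> l \in LQ -> j \in IQ -> m \in LQ ->
      [/\ i = j, x = y & l = m].
    move=> iIQ lLQ jIQ mLQ.
    have [u def_u] := entry_surj x iIQ lLQ.
    have [v def_v] := entry_surj y jIQ mLQ.
    have /within0 eq_uv := eqC u v.
    by move: def_u; rewrite eq_uv def_v => -[-> -> ->].
  split.
  - apply/eqP/cards1P; exists i0; apply/setP=> i; rewrite inE.
    apply/idP/eqP => [iIQ|-> //].
    by have [] := uniq_entry i 1%g l0 i0 1%g l0 iIQ l0LQ i0IQ l0LQ.
  - apply/eqP/cards1P; exists l0; apply/setP=> l; rewrite inE.
    apply/idP/eqP => [lLQ|-> //].
    by have [] := uniq_entry i0 1%g l i0 1%g l0 i0IQ lLQ i0IQ l0LQ.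
  - apply/setP=> x; rewrite !inE; apply/esym/eqP.
    by have [] := uniq_entry i0 x l0 i0 1%g l0 i0IQ l0LQ i0IQ l0LQ.
apply/within0/entry_inj.
have [i [x [l [-> iIQ lLQ]]]] := entryP u.
have [j [y [m [-> jIQ mLQ]]]] := entryP v.
have x1 (z : gT) : z = 1%g by apply/set1P; move: (in_setT z); rewrite G1.
have /eqP/cards1P[i1 def_IQ] := IQ1; have /eqP/cards1P[l1 def_LQ] := LQ1.
move: iIQ jIQ lLQ mLQ; rewrite def_IQ def_LQ.
by move=> /set1P-> /set1P-> /set1P-> /set1P->; rewrite (x1 x) (x1 y).
Qed.

Lemma component_within1 :
  (forall u v : C, within 1 u v) <->
  (forall l i, l \in LQ -> i \in IQ -> P l i = None).
Proof.
split=> [bound l i lLQ iIQ | zero u v]; last first.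
  apply/within1; rewrite component_adj_or_eq.
  have [i [x [l [-> iIQ lLQ]]]] := entryP u.
  have [j [y [m [-> jIQ mLQ]]]] := entryP v.
  by apply: commutes_zero; apply: zero.
(* Test vertices [(i, 1, l)] and [(j, 1, l)] with [P l j] zero: commuting gives [P l i] zero, since
   the alternative [i = j] would make [P l j] non-zero. *)
have [j jIQ lj] := row_zero lLQ.
have [u def_u] := entry_surj 1%g iIQ lLQ.
have [v def_v] := entry_surj 1%g jIQ lLQ.
have /within1 := bound u v; rewrite component_adj_or_eq def_u def_v.
by case/commutes_Some=> [[]|[-> _ []]].
Qed.

Lemma common_neighbour i x l j y m :
    i \in IQ -> l \in LQ -> j \in IQ -> m \in LQ ->
    (forall u v : C, within 2 u v) ->
  exists k z n, [/\ k \in IQ, n \in LQ,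
    commutes (Some (i, x, l)) (Some (k, z, n)) &
    commutes (Some (k, z, n)) (Some (j, y, m))].
Proof.
move=> iIQ lLQ jIQ mLQ bound.
have [u def_u] := entry_surj x iIQ lLQ.
have [v def_v] := entry_surj y jIQ mLQ.
have /within2[w] := bound u v.
have [k [z [n [def_w kIQ nLQ]]]] := entryP w.
by rewrite !component_adj_or_eq def_u def_v def_w; exists k, z, n.
Qed.

Lemma component_within2 :
  (forall u v : C, within 2 u v) <->
  (forall l m, l \in LQ -> m \in LQ -> l <> m ->
     exists i, [/\ i \in IQ, P l i = None & P m i = None]) /\
  (forall i j, i \in IQ -> j \in IQ -> i <> j ->
     exists l, [/\ l \in LQ, P l i = None & P l j = None]).
Proof.
split=> [bound | [rows cols] u v].
  split=> [l m lLQ mLQ neq_lm | i j iIQ jIQ neq_ij].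
    (* Join [(i, 1, l)] to [(i, 1, m)] through a middle vertex [(k, z, n)]. If both commutations
       come from zeros, [k] is the common zero column. If exactly one comes from equal indices, an
       entry is both zero and non-zero; if both do, [l = n = m]. *)
    have [i iIQ mi] := row_zero mLQ.
    have [k [z [n [kIQ _ uw wv]]]] :=
      common_neighbour 1%g 1%g iIQ lLQ iIQ mLQ bound.
    case/commutes_Some: uw => [[lk ni]|[eq_ik eq_ln li]];
      case/commutes_Some: wv => [[ni' mk]|[eq_ki eq_nm nk]]; try congruence.
    by exists k.
  (* Dually, the endpoints share the row [l], and the row [n] of the middle vertex is the
     witness. *)
  have [l lLQ lj] := col_zero jIQ.
  have [k [z [n [_ nLQ uw wv]]]] :=
    common_neighbour 1%g 1%g iIQ lLQ jIQ lLQ bound.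
  case/commutes_Some: uw => [[lk ni]|[eq_ik eq_ln li]];
    case/commutes_Some: wv => [[nj lk']|[eq_kj eq_nl nk]]; try congruence.
  by exists n.
have [i [x [l [def_u iIQ lLQ]]]] := entryP u.
have [j [y [m [def_v jIQ mLQ]]]] := entryP v.
have [k [kIQ lk mk]] : exists k, [/\ k \in IQ, P l k = None & P m k = None].
  (* The hypothesis [rows] speaks only of distinct rows; for [l = m] any zero of the row will do. *)
  case: (eqVneq l m) => [<-|/eqP/rows]; last exact.
  by have [k] := row_zero lLQ; exists k.
have [n [nLQ ni nj]] : exists n, [/\ n \in LQ, P n i = None & P n j = None].
  case: (eqVneq i j) => [<-|/eqP/cols]; last exact.
  by have [n] := col_zero iIQ; exists n.
have [w def_w] := entry_surj 1%g kIQ nLQ.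
by apply/within2; exists w;
  rewrite component_adj_or_eq ?def_u ?def_v def_w commutes_zero.
Qed.

End ReesCommutation.

(** * Zeros in the rows and columns of a 0-closure *)

Section ZeroClosure.
Variables (gT : finGroupType) (I L : finType) (P : L -> I -> option gT).
Variables (l : L) (i : I).
Hypothesis li_zero : P l i = None.

Lemma zclosure_step_base k :
  i \in (zclosure_step P l i k).1 /\ l \in (zclosure_step P l i k).2.
Proof.
elim: k => [|k]; first by rewrite /= !inE.
rewrite /=; case: (zclosure_step P l i k) => A B /= [iA lB].
by rewrite !inE iA lB.
Qed.

(** At the start [i] and [l] witness each other. Later an index is added only because of a zero
    against an index already present, and old witnesses are kept, so the property passes to every
    stage. *)
Lemma zclosure_step_zero k :
  let: (A, B) := zclosure_step P l i k in
  (forall m, m \in B -> exists2 j, j \in A & P m j = None) /\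
  (forall j, j \in A -> exists2 m, m \in B & P m j = None).
Proof.
elim: k => [|k] /=.
  by split=> [m|j] /set1P->; [exists i | exists l]; rewrite ?inE.
case: (zclosure_step P l i k) => A B [rows cols].
split=> [m | j]; rewrite !inE => /orP[].
- by case/rows=> j jA mj; exists j; rewrite // inE jA.
- by case/existsP=> j /andP[jA /eqP mj]; exists j; rewrite // inE jA.
- by case/cols=> m mB mj; exists m; rewrite // inE mB.
- by case/existsP=> m /andP[mB /eqP mj]; exists m; rewrite // inE mB.
Qed.

End ZeroClosure.

(** * Assembling the three diameter criteria *)

Theorem proposition4p19 (gT : finGroupType) (I L : finType)
    (P : L -> I -> option gT) (LQ : {set L}) (IQ : {set I})
    (I_nonempty : (0 < #|I|)%N) (L_nonempty : (0 < #|L|)%N)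
    (P_regular : regular_matrix P)
    (P_zero : exists l i, P l i = None)
    (Q_closure : zclosure_submatrix P LQ IQ) :
  [/\ diam (component P LQ IQ) = Some 0%N <->
        [/\ #|IQ| = 1%N, #|LQ| = 1%N & [set: gT] = 1%g],
      diam (component P LQ IQ) = Some 1%N <->
        [\/ (1 < #|IQ|)%N, (1 < #|LQ|)%N | [set: gT] <> 1%g] /\
        (forall l i, l \in LQ -> i \in IQ -> P l i = None)
    & diam (component P LQ IQ) = Some 2%N <->
        [/\ exists l i, [/\ l \in LQ, i \in IQ & P l i <> None],
            forall l m, l \in LQ -> m \in LQ -> l <> m ->
              exists i, [/\ i \in IQ, P l i = None & P m i = None]
          & forall i j, i \in IQ -> j \in IQ -> i <> j ->
              exists l, [/\ l \in LQ, P l i = None & P l j = None]]].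
Proof.
have [l0 [i0 [l0i0 def_Q]]] := Q_closure.
have := zclosure_step_base P l0 i0 (zeta P l0 i0).
have := zclosure_step_zero l0i0 (zeta P l0 i0).
rewrite def_Q => -[row_zero col_zero] /= [i0IQ l0LQ].
have IQ_gt0 : 0 < #|IQ| by apply/card_gt0P; exists i0.
have LQ_gt0 : 0 < #|LQ| by apply/card_gt0P; exists l0.
have le0 := component_within0 P_regular P_zero IQ_gt0 LQ_gt0.
have le1 := component_within1 P_regular P_zero row_zero.
have le2 := component_within2 P_regular P_zero row_zero col_zero.
(* The negation of the criterion for diameter 0 becomes condition (a) of (2): as both cardinals are
   positive, differing from 1 means exceeding 1. *)
have not_point :
    ~ [/\ #|IQ| = 1, #|LQ| = 1 & [set: gT] = 1%g] <->
    [\/ 1 < #|IQ|, 1 < #|LQ| | [set: gT] <> 1%g].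
  split=> [not1|[IQ_gt1 [IQ1]|LQ_gt1 [_ LQ1]|G_neq1 [_ _ /G_neq1]] //].
  - case: (ltngtP #|IQ| 1) not1 => [||IQ1];
      [by case: #|IQ| IQ_gt0 | by constructor 1|].
    case: (ltngtP #|LQ| 1) => [||LQ1];
      [by case: #|LQ| LQ_gt0 | by constructor 2|].
    by move=> not1; constructor 3 => G1; apply: not1.
  - by rewrite IQ1 in IQ_gt1.
  - by rewrite LQ1 in LQ_gt1.
have not_zero :
    ~ (forall l i, l \in LQ -> i \in IQ -> P l i = None) <->
    exists l i, [/\ l \in LQ, i \in IQ & P l i <> None].
  split=> [nz|[l [i [lLQ iIQ li]]] zero]; last by apply: li; apply: zero.
  (* A finite search over the entries extracts the non-zero one constructively. *)
  case: (pickP [pred t : L * I |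
    [&& t.1 \in LQ, t.2 \in IQ & P t.1 t.2 != None]]).
    by case=> l i /and3P[lLQ iIQ /eqP li]; exists l, i.
  move=> zero; case: nz => l i lLQ iIQ; apply/eqP.
  by have /= := zero (l, i); rewrite lLQ iIQ => /negbFE.
have d0 := diam_eq0 (component P LQ IQ).
have d1 := diam_eqS (component P LQ IQ) 0.
have d2 := diam_eqS (component P LQ IQ) 1.
(* Diameter 1 means bound 1 without bound 0, and diameter 2 means bound 2 without bound 1; with the
   criteria above, the rest is propositional. *)
split; [by tauto | by clear d2 le2; tauto |].
split=> [/d2[/le2[rows cols] nz]|[/not_zero nz rows cols]].
  by split=> //; apply/not_zero => /le1.
by apply/d2; split; [apply/le2 | move/le1].
Qed.
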